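(* Let $n\ge 1$ and let $w$ be an involution in the symmetric group $\mathfrak{S}_n$. Let $\mathrm{Br}(\mathcal{I}(\mathfrak{S}_n))$ be the poset of all involutions in $\mathfrak{S}_n$ with the order induced from the Bruhat order on $\mathfrak{S}_n$. The principal order ideal $\{u\in\mathcal{I}(\mathfrak{S}_n): u\le w\}$ generated by $w$ in $\mathrm{Br}(\mathcal{I}(\mathfrak{S}_n))$ is (isomorphic to) a Boolean lattice if and only if $w$ avoids the patterns $4321$, $45312$ and $456123$.
   Context: $\mathfrak{S}_n$ is the group of permutations of $[n]=\{1,\dots,n\}$. An involution is an element of order at most two (so the identity is included); $\mathcal{I}(\mathfrak{S}_n)$ is the set of involutions in $\mathfrak{S}_n$. The Bruhat order on $\mathfrak{S}_n$ is the usual (strong) Bruhat order with respect to the Coxeter generators $\mathfrak{s}_i=(i,i+1)$, $i\in[n-1]$: $u\le w$ iff $w=ut_1\cdots t_m$ ($m\ge 0$) for some transpositions $t_1,\dots,t_m$ such that the number of inversions strictly increases along the sequence $u,\ ut_1,\ ut_1t_2,\dots,\ ut_1\cdots t_m$. For $\pi\in\mathfrak{S}_n$ and $p\in\mathfrak{S}_m$ with $m\le n$, $\pi$ contains the pattern $p$ if there are $1\le i_1<\cdots<i_m\le n$ such that for all $j,k\in[m]$: $\pi(i_j)<\pi(i_k)$ iff $p(j)<p(k)$. If $\pi$ does not contain $p$ (in particular if $m>n$), it avoids $p$. Patterns are written in one-line notation $p(1)p(2)\cdots p(m)$. *)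

(* Defs.v *)
From mathcomp Require Import all_boot all_fingroup.

Set Implicit Arguments.
Unset Strict Implicit.
Unset Printing Implicit Defensive.

Local Open Scope group_scope.

(* Permutations act on 'I_n = {0, ..., n-1} instead of {1, ..., n}. *)

Definition involutions (n : nat) : {set 'S_n} := [set u : 'S_n | (#[u] <= 2)%N].

Definition inversions (n : nat) (u : 'S_n) : {set 'I_n * 'I_n} :=
  [set ij : 'I_n * 'I_n | (ij.1 < ij.2)%N && (u ij.2 < u ij.1)%N].

(* Products of permutations in MathComp compose from left to right, so that
   [tperm i j * u] is the map x |-> u (tperm i j x), which is u t in the usual
   convention, with t the transposition (i, j). *)
Definition bruhat_step (n : nat) : rel 'S_n := fun u v =>
  [exists i : 'I_n, exists j : 'I_n, (i != j) && (v == tperm i j * u)]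
  && (#|inversions u| < #|inversions v|)%N.

Definition bruhat (n : nat) : rel 'S_n := connect (@bruhat_step n).

Definition involution_ideal (n : nat) (w : 'S_n) : {set 'S_n} :=
  [set u in involutions n | bruhat u w].

(* The subset A of T, ordered by the restriction of le, is isomorphic to the
   lattice of all subsets of a k-element set, for some k. *)
Definition boolean_lattice (T : finType) (le : rel T) (A : {set T}) : Prop :=
  exists (k : nat) (f : T -> {set 'I_k}),
    [/\ {in A &, injective f},
        f @: A = [set: {set 'I_k}]
      & {in A &, forall x y, le x y = (f x \subset f y)}].

(* The pattern p is given in one-line notation, as the sequence of its values. *)
Definition contains_pattern (n : nat) (w : 'S_n) (p : seq nat) : Prop :=
  exists f : 'I_(size p) -> 'I_n,
    (forall j k : 'I_(size p), (j < k)%N -> (f j < f k)%N) /\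
    (forall j k : 'I_(size p),
       (w (f j) < w (f k))%N = (nth 0%N p j < nth 0%N p k)%N).

Definition avoids_pattern (n : nat) (w : 'S_n) (p : seq nat) : Prop :=
  ~ contains_pattern w p.

(* Main.v *)
(* Read an involution as a diagram of arcs {x, w x}; an arc crosses the gap
   before i when x < i <= w x. All three patterns are avoided iff w is "thin":
   no gap crossed by two arcs is strictly straddled by an arc that leaves a
   margin of one point on each side. Since the numbers of x < p with w x >= q
   increase along the Bruhat order, thinness passes to smaller elements.

   The support of u is its set of crossed gaps; the atoms below u are the
   simple transpositions at these gaps. If w is not thin, some smaller
   involution has the same support, hence lies above the same atoms, which
   cannot happen in a Boolean lattice. If w is thin, u |-> support u is an
   isomorphism from the ideal to the subsets of the support of w: an involution
   below w is non-nesting, so it is determined by its openers and closers, and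
   these can be read off its support; conversely any subset is reached by
   induction, uncrossing the gap before the first closer of w and crossing it
   again, if needed, by the lifting property. *)
Require Import Defs.
From mathcomp Require Import all_boot all_fingroup cyclic zify.

Set Implicit Arguments.
Unset Strict Implicit.
Unset Printing Implicit Defensive.

(** * Ordinals compared as natural numbers *)

Lemma ord_neq_nat n (a b : 'I_n) : a <> b -> nat_of_ord a <> nat_of_ord b.
Proof. by move=> h /ord_inj. Qed.

Lemma ord_eq_nat n (a b : 'I_n) : a = b -> nat_of_ord a = nat_of_ord b.
Proof. by move=> ->. Qed.

Ltac ord_hyps := repeat match goal with
  | H : is_true (?a != ?b) |- _ => move/eqP/ord_neq_nat in H
  | H : @eq _ ?a ?b |- _ => apply ord_eq_nat in H
  | H : ~ (@eq _ ?a ?b) |- _ => apply ord_neq_nat in H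
  | |- @eq _ _ _ => apply: ord_inj
  | |- is_true (_ != _) => apply/eqP
  | |- ~ @eq _ _ _ => move=> ?
  end.
Ltac olia := intros; ord_hyps; lia.

(** * The Bruhat order: steps, inverses, lifting *)

Section Bruhat.
Local Open Scope group_scope.
Variable n : nat.
Implicit Types (u v w : 'S_n) (a b c x y z : 'I_n).

(* The injection moves an inversion by the transposition whenever the moved pair
   is still increasing; it misses the new inversion (a, b). *)
Lemma card_inversions_tperm u a b : (a < b)%N -> (u a < u b)%N ->
  (#|inversions u| < #|inversions (tperm a b * u)|)%N.
Proof.
move=> ltab ltu; set t := tperm a b; set v := t * u.
pose phi (p : 'I_n * 'I_n) := if (t p.1 < t p.2)%N then (t p.1, t p.2) else p.
have vE x : v x = u (t x) by rewrite permM.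
have tK : involutive t by exact: tpermK.
have phi_inj : {in inversions u &, injective phi}.
  move=> [i j] [i' j']; rewrite !inE /phi /= => /andP[lij _] /andP[lij' _].
  case: ifP => h; case: ifP => h' // [e1 e2].
  - by congr (_, _); apply: (can_inj tK).
  - by move: h'; rewrite -e1 -e2 !tK lij.
  - by move: h; rewrite e1 e2 !tK lij'.
rewrite -(card_in_imset phi_inj).
apply: proper_card; apply/properP; split.
  apply/subsetP => _ /imsetP[[i j] + ->]; rewrite !inE /phi /= => /andP[lij luij].
  case: ifP => h /=; first by rewrite h !vE !tK.
  move: h; rewrite lij !vE /t.
  by case: tpermP => [?|?|? ?]; case: tpermP => [?|?|? ?]; subst; olia.
exists (a, b); first by rewrite !inE /= ltab !vE /t tpermL tpermR.
apply/imsetP => -[[i j]]; rewrite inE /= => /andP[lij luij]; rewrite /phi /=.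
case: ifP => h [ea eb]; last by subst; olia.
have := tK i; have := tK j; rewrite -ea -eb /t tpermL tpermR => ? ?; olia.
Qed.

(** If [u] were decreasing on the pair [a < b], the preceding lemma applied to [v] would show that
    the step lowers the inversion number. *)
Lemma bruhat_stepP u v :
  reflect (exists a b, [/\ (a < b)%N, (u a < u b)%N & v = tperm a b * u])
          (bruhat_step u v).
Proof.
apply: (iffP andP) => [[/existsP[a /existsP[b /andP[neq /eqP ev]]] lt]|].
  wlog lab : a b neq ev / (a < b)%N.
    move=> H; case: (ltngtP a b) => [?|?|/ord_inj e]; first exact: (H a b).
      by apply: (H b a); rewrite 1?eq_sym // tpermC.
    by rewrite e eqxx in neq.
  exists a, b; split=> //; case: (ltngtP (u a) (u b)) => // [h|/ord_inj/perm_inj e].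
    have := @card_inversions_tperm v a b lab.
    rewrite {1 2}ev !permM tpermL tpermR => /(_ h).
    by rewrite ev mulgA tperm2 mul1g -ev; lia.
  by rewrite e eqxx in neq.
move=> [a [b [lab lu ->]]]; split; last exact: card_inversions_tperm.
by apply/existsP; exists a; apply/existsP; exists b; rewrite eqxx andbT; apply/eqP; olia.
Qed.

Lemma bruhat_tperm v a b : (a < b)%N -> (v b < v a)%N -> bruhat (tperm a b * v) v.
Proof.
move=> lab lv; apply/connect1/bruhat_stepP; exists a, b; split=> //.
  by rewrite !permM tpermL tpermR.
by rewrite mulgA tperm2 mul1g.
Qed.

Lemma bruhat_trans u v w : bruhat u v -> bruhat v w -> bruhat u w.
Proof. exact: connect_trans. Qed.

Lemma bruhat_ind (P : 'S_n -> 'S_n -> Prop) :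
  (forall u, P u u) ->
  (forall u v w, bruhat_step u v -> bruhat v w -> P v w -> P u w) ->
  forall u v, bruhat u v -> P u v.
Proof.
move=> P0 PS u v /connectP[p]; elim: p u => [|z p IH] u /=; first by move=> _ ->.
case/andP=> st pth ev; apply: (PS _ z) => //; last exact: IH.
by apply/connectP; exists p.
Qed.

Lemma tperm_mul_perm u a b : tperm a b * u = u * tperm (u a) (u b).
Proof. by rewrite -tpermJ conjgE mulgA mulgV mul1g. Qed.

(** Inverting a step exchanges positions and values: the inverse of [tperm a b * u] is
    [tperm (u a) (u b) * u^-1]. *)
Lemma bruhatV u v : bruhat u v -> bruhat u^-1 v^-1.
Proof.
move: u v; apply: bruhat_ind => [u|u z v]; first exact: connect0.
move=> /bruhat_stepP[a [b [lab lu ->]]] _.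
apply: bruhat_trans; apply/connect1/bruhat_stepP.
exists (u a), (u b); split=> //; first by rewrite !permK.
by rewrite tperm_mul_perm invMg tpermV.
Qed.

Lemma tperm_adj_lt a b x y : b = a.+1 :> nat -> (x < y)%N ->
  (tperm a b x < tperm a b y)%N \/ (x = a /\ y = b).
Proof.
by move=> eb; case: tpermP => [?|?|? ?]; case: tpermP => [?|?|? ?]; subst; try (by left; olia); right.
Qed.

(* Multiplying a whole chain by a simple transposition keeps it a chain, unless
   that transposition is one of its steps. *)
Lemma bruhat_lift u v a b : b = a.+1 :> nat -> bruhat u v ->
  bruhat (tperm a b * u) v \/ bruhat (tperm a b * u) (tperm a b * v).
Proof.
move=> eb; move: u v; set s := tperm a b; apply: bruhat_ind => [u|u z v]; first by right; exact: connect0.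
move=> /bruhat_stepP[x [y [lxy lu ->]]] lezv IH.
case: (tperm_adj_lt eb lxy) => [lt|[ex ey]]; last by left; rewrite ex ey in lezv.
have st : bruhat (s * u) (s * (tperm x y * u)).
  apply/connect1/bruhat_stepP; exists (s x), (s y); split=> //.
    by rewrite !permM /s !tpermK.
  by rewrite !mulgA [X in _ = X * _]tperm_mul_perm /s !tpermK.
by case: IH => h; [left|right]; apply: bruhat_trans h.
Qed.

(** Since [v] has a descent at [a], [tperm a b * v] lies below [v], so both outcomes of
    [bruhat_lift] end below [v]. *)
Lemma bruhat_lift_descent u v a b : b = a.+1 :> nat -> (v b < v a)%N ->
  bruhat u v -> bruhat (tperm a b * u) v.
Proof.
move=> eb lv /(bruhat_lift eb)[//|h]; apply: bruhat_trans h _.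
by apply: bruhat_tperm; lia.
Qed.


(** * Involutions and their arcs *)

Lemma involutionsP u : reflect (involutive u) (u \in involutions n).
Proof.
rewrite inE; apply: (iffP idP) => [ou x|uK].
  have : u ^+ 2 = 1.
    apply/eqP; rewrite -order_dvdn; have := order_gt0 u; move: ou.
    by case: #[u] => [|[|[|]]].
  by move/permP/(_ x); rewrite expgS expg1 permM perm1.
apply: dvdn_leq => //; rewrite order_dvdn; apply/eqP/permP=> x.
by rewrite expgS expg1 permM perm1.
Qed.

Lemma involutive_invg u : involutive u -> u^-1 = u.
Proof. by move=> uK; apply/permP => x; apply: (@perm_inj _ u); rewrite permKV uK. Qed.

Lemma conj_tpermE u a b : tperm a b * u * tperm a b = u ^ tperm a b.
Proof. by rewrite conjgE tpermV mulgA. Qed.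

Lemma involutive_conj_tperm u a b : involutive u -> involutive (tperm a b * u * tperm a b).
Proof. by move=> uK x; rewrite !permM !tpermK uK tpermK. Qed.

(** The first step down multiplies on the left; the second, on the right, is the inverse of a left
    step below [u * tperm a b]. *)
Lemma bruhat_conj_tperm u a b : involutive u -> (a < b)%N -> (u b < u a)%N ->
  (tperm a b (u b) < tperm a b (u a))%N -> bruhat (tperm a b * u * tperm a b) u.
Proof.
move=> uK lab lu lt; apply: bruhat_trans (bruhat_tperm lab lu).
have := @bruhat_tperm (u * tperm a b) a b lab; rewrite !permM => /(_ lt)/bruhatV.
by rewrite !invMg !tpermV (involutive_invg uK).
Qed.

Lemma remove_arc_involutive u a : involutive u -> involutive (tperm a (u a) * u).
Proof.
move=> uK x; have e : tperm a (u a) * u = u * tperm a (u a).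
  by rewrite tperm_mul_perm uK tpermC.
by rewrite {2}e !permM tpermK uK.
Qed.

Lemma remove_arc_step u a : involutive u -> (a < u a)%N -> bruhat (tperm a (u a) * u) u.
Proof. by move=> uK lt; apply: bruhat_tperm; rewrite ?uK. Qed.

Lemma remove_arc_inversions u a : involutive u -> (a < u a)%N ->
  (#|inversions (tperm a (u a) * u)| < #|inversions u|)%N.
Proof.
move=> uK lt; have := @card_inversions_tperm (tperm a (u a) * u) a (u a) lt.
by rewrite mulgA tperm2 mul1g; apply; rewrite !permM tpermL tpermR uK.
Qed.

Lemma exists_arc u x : involutive u -> u x != x -> exists2 a : 'I_n, (a < u a)%N & (a == x) || (a == u x).
Proof.
move=> uK neq; case: (ltngtP x (u x)) => h.
- by exists x; rewrite ?eqxx.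
- by exists (u x); rewrite ?uK ?eqxx ?orbT.
- by move/ord_inj: h neq => <-; rewrite eqxx.
Qed.

Lemma bruhat1_involution u : involutive u -> bruhat 1 u.
Proof.
have [m] := ubnP #|inversions u|; elim: m u => // m IH u lt uK.
case: (pickP (fun x => u x != x)) => [x neq|id_u].
  have [a la _] := exists_arc uK neq.
  apply: bruhat_trans (remove_arc_step uK la); apply: IH (remove_arc_involutive a uK).
  by have := remove_arc_inversions uK la; lia.
suff -> : u = 1 by exact: connect0.
by apply/permP => x; rewrite perm1; apply/eqP/negbFE/id_u.
Qed.

(** Removing the other arcs one by one leaves only [{a, u a}]. *)
Lemma bruhat_arc u a : involutive u -> (a < u a)%N -> bruhat (tperm a (u a)) u.
Proof.
have [m] := ubnP #|inversions u|; elim: m u => // m IH u lt uK la.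
case: (pickP (fun x => (u x != x) && (x != a) && (x != u a))) => [x /andP[/andP[neq xa] xua]|h].
  have [c lc ecx] := exists_arc uK neq.
  have ca : c != a.
    by case/orP: ecx => /eqP->//; apply: contra_neq xua => <-; rewrite uK.
  have cua : c != u a.
    by case/orP: ecx => /eqP->//; rewrite (inj_eq perm_inj).
  have ea : (tperm c (u c) * u) a = u a.
    by rewrite permM tpermD //; apply: contra_neq cua => <-; rewrite uK.
  apply: bruhat_trans (remove_arc_step uK lc).
  rewrite -ea; apply: IH; last by rewrite ea.
    by have := remove_arc_inversions uK lc; lia.
  exact: remove_arc_involutive.
suff {2}-> : u = tperm a (u a) by exact: connect0.
apply/permP => x; case: tpermP => [->//|->|/eqP xa /eqP xua]; first exact: uK.
by move: (h x); rewrite xa xua !andbT => /negbFE/eqP.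
Qed.

(** Conjugation by [tperm a b] moves the left end of the arc from [a] to [b]; the next lemma moves
    the right end. *)
Lemma bruhat_tperm_tperm a b c : (a <= b < c)%N -> bruhat (tperm b c) (tperm a c).
Proof.
move=> /andP[lab lbc]; case: (eqVneq a b) => [->|neq]; first exact: connect0.
have -> : tperm b c = tperm a b * tperm a c * tperm a b.
  by rewrite conj_tpermE tpermJ tpermL tpermD //; apply/eqP; olia.
apply: bruhat_conj_tperm; first exact: tpermK.
- olia.
- by rewrite tpermL [tperm a c b]tpermD //; olia.
- by rewrite tpermL [tperm a c b]tpermD ?tpermR ?tpermD //; olia.
Qed.

Lemma bruhat_tperm_tperm_r a b c : (a < b <= c)%N -> bruhat (tperm a b) (tperm a c).
Proof.
move=> /andP[lab lbc]; case: (eqVneq b c) => [->|neq]; first exact: connect0.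
have -> : tperm a b = tperm b c * tperm a c * tperm b c.
  by rewrite conj_tpermE tpermJ tpermR tpermD //; apply/eqP; olia.
apply: bruhat_conj_tperm; first exact: tpermK.
- olia.
- by rewrite tpermR tpermD //; olia.
- by rewrite tpermR [tperm a c b]tpermD ?tpermL ?[tperm b c a]tpermD //; olia.
Qed.

(** * Crossed gaps, rank counts and thinness *)

(** Gaps are natural numbers, so that [x.+1] and [x.+2] need no bound. *)
Definition crossed u (i : nat) := [exists x : 'I_n, (x < i <= u x)%N].

Lemma crossedP u i : reflect (exists x : 'I_n, (x < i <= u x)%N) (crossed u i).
Proof. exact: existsP. Qed.

(** An arc over the gap lies below [u], and shrinking it from both ends leaves [{a, b}]. *)
Lemma bruhat_tperm_crossed u a b : b = a.+1 :> nat -> involutive u -> crossed u b ->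
  bruhat (tperm a b) u.
Proof.
move=> eb uK /crossedP[x /andP[xb bx]].
apply: bruhat_trans (bruhat_arc uK (leq_trans xb bx)).
apply: (@bruhat_trans _ (tperm a (u x))); first by apply: bruhat_tperm_tperm_r; lia.
by apply: bruhat_tperm_tperm; lia.
Qed.

(** The corner counts of the permutation matrix, whose comparison describes the Bruhat order. *)
Definition rank_over u (p q : nat) := #|[set x : 'I_n | (x < p)%N && (q <= u x)%N]|.

Lemma rank_over_mono u v p q : bruhat u v -> (rank_over u p q <= rank_over v p q)%N.
Proof.
move: u v; apply: bruhat_ind => [//|u z v].
move=> /bruhat_stepP[a [b [lab lu ->]]] _; apply: leq_trans; set t := tperm a b.
(* If both positions are below [p], the transposition only permutes the counted points; otherwise at
   most [a] is counted, and its value grows. *)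
case: (ltnP b p) => hp.
  have -> : rank_over u p q = #|t @: [set x : 'I_n | (x < p)%N && (q <= u x)%N]|.
    by rewrite card_imset //; exact: perm_inj.
  apply/subset_leq_card/subsetP => _ /imsetP[x + ->]; rewrite !inE permM tpermK.
  by case/andP=> xp ->; rewrite andbT /t; case: tpermP => [?|?|//]; lia.
apply/subset_leq_card/subsetP => x; rewrite !inE permM => /andP[xp qx].
by rewrite xp /=; case: tpermP => [e|e|_ _//]; subst; lia.
Qed.

Lemma rank_over_gt0 u p q : reflect (exists x : 'I_n, (x < p)%N /\ (q <= u x)%N) (0 < rank_over u p q)%N.
Proof.
apply: (iffP card_gt0P) => [[x]|[x [h1 h2]]]; first by rewrite inE => /andP[? ?]; exists x.
by exists x; rewrite inE h1.
Qed.

Lemma crossed_mono u v i : bruhat u v -> crossed u i -> crossed v i.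
Proof.
move=> le /crossedP[x /andP[xi ix]].
have : (0 < rank_over v i i)%N.
  by apply: leq_trans (rank_over_mono i i le); apply/rank_over_gt0; exists x.
by case/rank_over_gt0=> y [? ?]; apply/crossedP; exists y; apply/andP.
Qed.

(* rank_over w i.-1 i.+1 counts the arcs x < i - 1, i < w x. *)
Definition thin w := forall i, (1 < rank_over w i i)%N -> rank_over w i.-1 i.+1 = 0%N.

Lemma rank_over_gt1 u i x y : x != y -> (x < i <= u x)%N -> (y < i <= u y)%N ->
  (1 < rank_over u i i)%N.
Proof.
move=> neq hx hy; have -> : 2%N = #|[set x; y]| by rewrite cards2 neq.
by apply/subset_leq_card/subsetP=> z; rewrite !inE => /orP[]/eqP->.
Qed.

(** Both counts are bounded by those of [w], so the two crossing arcs may come from [u] and the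
    straddling one from another element [v]. *)
Lemma thin_excl w u v i x y z : thin w -> bruhat u w -> bruhat v w -> x != y ->
  (x < i <= u x)%N -> (y < i <= u y)%N -> (z.+1 < i)%N -> (v z <= i)%N.
Proof.
move=> thw uw vw neq hx hy hz; rewrite leqNgt; apply/negP => lt.
have := thw i (leq_trans (rank_over_gt1 neq hx hy) (rank_over_mono i i uw)).
have : (0 < rank_over w i.-1 i.+1)%N; last by lia.
apply: leq_trans (rank_over_mono _ _ vw); apply/rank_over_gt0; exists z; lia.
Qed.

Lemma thin_le u w : thin w -> bruhat u w -> thin u.
Proof.
move=> thw uw i /leq_trans/(_ (rank_over_mono i i uw))/thw.
by have := rank_over_mono i.-1 i.+1 uw; lia.
Qed.

(** * Thin involutions are determined by their support *)

(** If the arc of [y] were nested in that of [x], both would cross the gap before [w y], and the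
    outer one would straddle it with a margin. *)
Lemma thin_non_nested w x y : thin w -> involutive w -> (x < y)%N -> (y < w y)%N -> (w x <= w y)%N.
Proof.
move=> thw wK xy ywy; rewrite leqNgt; apply/negP=> lt.
have neq : x != y by apply/eqP; olia.
have := @thin_excl w w w (w y) x y x thw (connect0 _ _) (connect0 _ _) neq.
by lia.
Qed.

(** Otherwise [v] has an arc from [a] and [u] an arc from [c] passing over [x]. Thinness forces [a]
    and [c] to be [x.-1], so [u x] is smaller and [u] crosses the gap before [x.-1]; [v] cannot
    cross it. *)
Lemma thin_closer w u v x : thin w -> involutive u -> involutive v -> bruhat u w -> bruhat v w ->
  (forall i, crossed u i = crossed v i) -> (u x < x)%N -> (v x < x)%N.
Proof.
move=> thw uK vK uw vw euv ux; rewrite ltnNge; apply/negP => vx.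
have /crossedP[a ha] : crossed v x by rewrite -euv; apply/crossedP; exists (u x); rewrite uK; lia.
have na : v a <> x by move=> e; have := vK a; rewrite e => ?; olia.
have na' : nat_of_ord (v a) <> x by move/ord_inj.
have /crossedP[c hc] : crossed u x.+1 by rewrite euv; apply/crossedP; exists a; lia.
have nc : c <> x by move=> ?; subst; lia.
have nc' : nat_of_ord c <> x by move/ord_inj.
have neq : c != u x by apply/eqP => ?; subst; rewrite uK in hc; lia.
have excl z := @thin_excl w u _ x c (u x) z thw uw _ neq.
rewrite uK in excl.
have exv z : (z.+1 < x)%N -> (v z <= x)%N by apply: excl => //; lia.
have exu z : (z.+1 < x)%N -> (u z <= x)%N by apply: excl => //; lia.
have := exv a; have := exu c => h1 h2.
have /crossedP[e he] : crossed v x.-1.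
  rewrite -euv; apply/crossedP; exists (u x); rewrite uK.
  have /ord_neq_nat : c <> u x by apply/eqP.
  lia.
have := exv e => h3.
(* The arc of [e] could only end at [x], which is not a closer of [v], or at [x.-1], which is the
   opener [a]. *)
have ne : v e <> x by move=> h; have := vK e; rewrite h => ?; olia.
have ne2 : v e <> a by move=> h; have := vK e; rewrite h => ?; olia.
olia.
Qed.

(** Mirror image of [thin_closer]: the two arcs over [x] end at [x.+1], and the contradiction arises
    at the gap before [x.+2]. *)
Lemma thin_opener w u v x : thin w -> involutive u -> involutive v -> bruhat u w -> bruhat v w ->
  (forall i, crossed u i = crossed v i) -> (x < u x)%N -> (x < v x)%N.
Proof.
move=> thw uK vK uw vw euv ux; rewrite ltnNge; apply/negP => vx.
have /crossedP[a ha] : crossed v x.+1 by rewrite -euv; apply/crossedP; exists x; lia.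
have na : a <> x by move=> e; subst; lia.
have na' : nat_of_ord a <> x by move/ord_inj.
have /crossedP[c hc] : crossed u x by rewrite euv; apply/crossedP; exists a; lia.
have nc : u c <> x by move=> h; have := uK c; rewrite h => ?; olia.
have nc' : nat_of_ord (u c) <> x by move/ord_inj.
have neq : c != x by apply/eqP; olia.
have exv z : (z.+1 < x.+1)%N -> (v z <= x.+1)%N by apply: (@thin_excl w u v x.+1 c x) => //; lia.
have exu z : (z.+1 < x.+1)%N -> (u z <= x.+1)%N by apply: (@thin_excl w u u x.+1 c x) => //; lia.
have := exv a; have := exu c => h1 h2.
have nuc : u c <> u x by move/perm_inj; olia.
have /crossedP[e he] : crossed v x.+2.
  rewrite -euv; apply/crossedP; exists x; olia.
have := exv e => h3.
have ne : e <> x by move=> h; subst; lia.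
have ne2 : e <> v a by move=> h; subst; rewrite vK in he; lia.
olia.
Qed.

(* At the first x where u and v differ, x opens an arc in both; then the closer
   u x of u also closes an arc of v, nested inside the arc of x. *)
Lemma thin_involution_inj w u v : thin w -> involutive u -> involutive v ->
  bruhat u w -> bruhat v w -> (forall i, crossed u i = crossed v i) -> u = v.
Proof.
move=> thw uK vK uw vw euv; have evu i := esym (euv i).
have main m : forall x, (x < m)%N -> u x = v x.
  elim: m => // m IH x; rewrite ltnS leq_eqVlt => /orP[/eqP ex|]; last exact: IH.
  wlog le : u v uK vK uw vw euv evu IH / (u x <= v x)%N.
    move=> H; case: (leqP (u x) (v x)) => h; first exact: H.
    by apply/esym/H => //; [move=> y /IH | lia].
  apply/eqP/negPn/negP => neq.
  (* If [x] closes an arc of [u], its opener comes earlier, where [u] and [v] agree. *)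
  have [h|h] := leqP x (u x); last first.
    have := IH (u x); rewrite uK -ex => /(_ h) e.
    by move: neq; rewrite {2}e vK eqxx.
  have lxv : (x < v x)%N by olia.
  have lxu := thin_opener thw vK uK vw uw evu lxv.
  have cl : (v (u x) < u x)%N.
    by apply: (thin_closer thw uK vK uw vw euv); rewrite uK.
  have nz : v (u x) <> x by move=> e; move: neq; rewrite -{2}e vK eqxx.
  have [zx|zx|/ord_inj//] := ltngtP (v (u x)) x.
    have := IH (v (u x)); rewrite -ex vK => /(_ zx)/perm_inj; olia.
  have := @thin_non_nested v x (v (u x)) (thin_le thw vw) vK zx.
  rewrite vK => /(_ cl); olia.
by apply/permP => x; exact: (main x.+1).
Qed.


(** * Realising every subset of the support *)

(** An adjacent transposition moves points across the gap before [b] only. *)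
Lemma crossed_tpermL u a b (i : nat) : b = a.+1 :> nat -> i != b -> crossed (tperm a b * u) i = crossed u i.
Proof.
move=> eb /eqP neq; set s := tperm a b.
have ltE x : (s x < i)%N = (x < i)%N.
  by rewrite /s; case: tpermP => [?|?|//]; subst; lia.
by apply/crossedP/crossedP => -[x hx]; exists (s x); move: hx; rewrite permM ?tpermK ltE.
Qed.

Lemma crossed_tpermR u a b (i : nat) : b = a.+1 :> nat -> i != b -> crossed (u * tperm a b) i = crossed u i.
Proof.
move=> eb /eqP neq.
have leE x : (i <= tperm a b x)%N = (i <= x)%N.
  by case: tpermP => [?|?|//]; subst; lia.
by apply/crossedP/crossedP => -[x hx]; exists x; move: hx; rewrite permM leE.
Qed.

Definition support u := [set i : 'I_n | crossed u i].

Lemma crossed_ord u i : crossed u i -> (i < n)%N.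
Proof. by case/crossedP=> x /andP[_ h]; apply: leq_ltn_trans (ltn_ord (u x)). Qed.

Lemma support_eq u v : support u = support v -> forall i, crossed u i = crossed v i.
Proof.
move=> e i; case: (ltnP i n) => h; first by have /setP/(_ (Ordinal h)) := e; rewrite !inE.
by apply/idP/idP => /crossed_ord; lia.
Qed.

(** If [{a, b}] is an arc, it is removed. Otherwise conjugation by [tperm a b] makes the arc ending
    at [b] end at [a], and an arc starting at [a] start at [b]. Any further arc over the gap would
    straddle it with a margin, against thinness. *)
Lemma uncross_first_closer w a b : thin w -> involutive w -> b = a.+1 :> nat -> (w b <= a <= w a)%N ->
  exists v, [/\ involutive v, bruhat v w & support v = support w :\ b].
Proof.
move=> thw wK eb /andP[wb wa]; set s := tperm a b.
have lab : (a < b)%N by lia.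
have lw : (w b < w a)%N.
  have : w b <> w a by move/perm_inj; olia.
  olia.
have excl := @thin_excl w w w b _ _ _ thw (connect0 _ _) (connect0 _ _).
have [e|ne] := eqVneq (w b) a.
  have ewa : w a = b by rewrite -e wK.
  exists (s * w); split.
  - by rewrite /s -ewa; apply: remove_arc_involutive.
  - exact: bruhat_tperm.
  apply/setP => i; rewrite !inE; have [->|neq] := eqVneq i b; last exact: crossed_tpermL.
  apply/negbTE/crossedP => -[x]; rewrite permM => /andP[xb].
  have [->|nxa] := eqVneq x a; first by rewrite tpermL e; lia.
  rewrite tpermD 1?eq_sym //; last by apply/eqP; olia.
  have nwx : w x <> b by rewrite -ewa => /perm_inj; apply/eqP.
  move=> bw; have := excl a x x; rewrite eq_sym nxa ewa leqnn => /(_ isT).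
  olia.
have nwab : w a <> b by move=> h; move: ne; rewrite -h wK eqxx.
have swb : s (w b) = w b by rewrite tpermD // 1?eq_sym //; apply/eqP; olia.
exists (s * w * s); split; first exact: involutive_conj_tperm.
- apply: bruhat_conj_tperm => //; rewrite -/s swb /s.
  by case: tpermP; olia.
apply/setP => i; rewrite !inE; have [->|neq] := eqVneq i b; last first.
  by rewrite crossed_tpermR // crossed_tpermL.
apply/negbTE/crossedP => -[x]; rewrite !permM -/s => /andP[xb].
have [->|nxa] := eqVneq x a; first by rewrite /s tpermL -/s swb; lia.
have -> : s x = x by rewrite tpermD 1?eq_sym //; apply/eqP; olia.
rewrite /s; case: tpermP => [h|_|_ nwx] bw.
- by have := wK x; rewrite h => h'; olia.
- by lia.
have nx : x != w b by apply/eqP => h; move: nwx; rewrite h wK.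
have := excl x (w b) x nx; rewrite wK; olia.
Qed.

(** Lifting at the descent of [w] puts [s * u] below [w]. If [s] and [u] do not commute, this is no
    involution; its inverse [u * s] is also below [w], and a second lifting gives the conjugate. *)
Lemma cross_gap u w a b : involutive u -> involutive w -> bruhat u w -> b = a.+1 :> nat ->
  (w b < w a)%N -> ~~ crossed u b ->
  exists v, [/\ involutive v, bruhat v w & support v = b |: support u].
Proof.
move=> uK wK uw eb lw ncr; set s := tperm a b.
have ua : (u a < b)%N.
  by rewrite ltnNge; apply: contra ncr => h; apply/crossedP; exists a; lia.
have ub : (b <= u b)%N.
  by rewrite leqNgt; apply: contra ncr => h; apply/crossedP; exists (u b); rewrite uK; lia.
have suw : bruhat (s * u) w by exact: bruhat_lift_descent.
have [com|ncom] := eqVneq (s * u) (u * s).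
  exists (s * u); split=> //.
  - by move=> x; rewrite {1}com !permM uK tpermK.
  apply/setP => i; rewrite !inE; have [->|neq] := eqVneq i b; last exact: crossed_tpermL.
  by apply/crossedP; exists a; rewrite permM tpermL; lia.
exists (s * u * s); split; first exact: involutive_conj_tperm.
- have := bruhatV suw.
  rewrite invMg tpermV !involutive_invg // -mulgA; exact: bruhat_lift_descent.
apply/setP => i; rewrite !inE; have [->|neq] := eqVneq i b; last first.
  by rewrite crossed_tpermR // crossed_tpermL.
(* If [u] fixed both [a] and [b], it would commute with [s]; so an arc ends at [a] or starts at [b],
   and conjugation stretches it over the gap. *)
apply/crossedP; have [eub|neub] := eqVneq (u b) b.
  have nua : u a <> a.
    move=> eua; move: ncom; rewrite /s tperm_mul_perm eua eub eqxx //.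
  exists (u a); rewrite !permM -/s.
  have -> : s (u a) = u a by rewrite tpermD //; apply/eqP; olia.
  by rewrite uK /s tpermL; olia.
exists a; rewrite !permM tpermL tpermD 1?eq_sym //; last by apply/eqP; olia.
lia.
Qed.

Lemma thin_sub_support w (J : {set 'I_n}) : thin w -> involutive w -> J \subset support w ->
  exists u, [/\ involutive u, bruhat u w & support u = J].
Proof.
have [m] := ubnP #|support w|; elim: m w J => // m IH w J lt thw wK sJ.
case: (pickP (fun b : 'I_n => w b < b)%N) => [b0 hb0|noc]; last first.
  exists w; split=> //; first exact: connect0.
  have e0 : support w = set0.
    apply/setP=> i; rewrite !inE; apply/negbTE/crossedP => -[x hx].
    by have := noc (w x); rewrite wK; lia.
  by move: sJ; rewrite e0 subset0 => /eqP.
have [b hb minb] := @arg_minnP _ b0 (fun b : 'I_n => w b < b)%N (@nat_of_ord n) hb0.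
(* A closer is positive, so [b] has a predecessor [a], which is not a closer by minimality. *)
have lt_a : (b.-1 < n)%N by have := ltn_ord b; lia.
pose a := Ordinal lt_a; have eb : b = a.+1 :> nat by rewrite /=; lia.
have hwa : (a <= w a)%N by rewrite leqNgt; apply/negP => /minb; rewrite eb ltnn.
have [|v [vK vw sv]] := @uncross_first_closer w a b thw wK eb; first by lia.
have bw : b \in support w by rewrite inE; apply/crossedP; exists (w b); rewrite wK; lia.
have ltv : (#|support v| < m)%N.
  by have := cardsD1 b (support w); rewrite -sv bw; lia.
have [|u [uK uv su]] := IH v (J :\ b) ltv (thin_le thw vw) vK; first by rewrite sv setSD.
have uw := bruhat_trans uv vw.
have [bJ|bJ] := boolP (b \in J); last first.
  exists u; split=> //; rewrite su; apply/setP=> i; rewrite !inE.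
  by case: eqVneq => [->|//]; rewrite (negbTE bJ).
have nwab : w b <> w a by move/perm_inj; olia.
have [||u' [u'K u'w su']] := @cross_gap u w a b uK wK uw eb; first by olia.
  by have /setP/(_ b) := su; rewrite !inE eqxx => ->.
by exists u'; split=> //; rewrite su' su setD1K.
Qed.

(** * The ideal below a thin involution *)

Lemma thin_boolean w : thin w -> involutive w -> boolean_lattice (@bruhat n) (involution_ideal w).
Proof.
move=> thw wK.
have idealP u : u \in involution_ideal w -> involutive u /\ bruhat u w.
  by rewrite inE => /andP[/involutionsP ? ?].
pose f u := [set k : 'I_#|support w| | crossed u (enum_val k)].
have fE u k : (k \in f u) = crossed u (enum_val k) by rewrite inE.
have f_sub u v : bruhat u w -> f u \subset f v -> support u \subset support v.
  move=> uw /subsetP sub; apply/subsetP => i; rewrite !inE => ui.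
  have iw : i \in support w by rewrite inE; apply: crossed_mono ui.
  by have := sub (enum_rank_in iw i); rewrite !fE enum_rankK_in // => /(_ ui).
exists #|support w|, f; split.
- move=> u v /idealP[uK uw] /idealP[vK vw] e.
  apply: (thin_involution_inj thw) => //; apply: support_eq.
  by apply/eqP; rewrite eqEsubset !f_sub // e.
- apply/setP => K; rewrite inE; apply/imsetP.
  have [|u [uK uw su]] := @thin_sub_support w (enum_val @: K) thw wK.
    by apply/subsetP=> _ /imsetP[k _ ->]; apply: enum_valP.
  exists u; first by rewrite inE uw andbT; apply/involutionsP.
  apply/setP => k; rewrite fE; have /setP/(_ (enum_val k)) := su.
  by rewrite inE => ->; rewrite mem_imset //; apply: enum_val_inj.
move=> u v /idealP[uK uw] /idealP[vK vw]; apply/idP/idP => [uv|sub].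
  by apply/subsetP => k; rewrite !fE; apply: crossed_mono.
(* Some involution below [v] has the support of [u]; by uniqueness it is [u] itself. *)
have [|u' [u'K u'v su']] := @thin_sub_support v (support u) (thin_le thw vw) vK.
  exact: f_sub.
suff -> : u = u' by [].
apply: (thin_involution_inj thw) => //; first exact: bruhat_trans vw.
by apply: support_eq; rewrite su'.
Qed.

(** * Bad configurations of arcs *)

(** Occurrences of 4321, 45312 and 456123, in this order, on sets of positions closed under [w],
    where [w] can be modified. *)
Variant bad_arcs w : Prop :=
| NestedArcs a b of (a < b)%N & (b < w b)%N & (w b < w a)%N
| CrossingArcsOverFixpoint a b c of (a < b)%N & (b < c)%N & w c = c & (c < w a)%N & (w a < w b)%N
| ThreeCrossingArcs a b c of (a < b)%N & (b < c)%N & (c < w a)%N & (w a < w b)%N & (w b < w c)%N.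

(* Whatever w does at the point b + 1 under both arcs is bad. *)
Lemma bad_crossing_arcs w a b : involutive w ->
  (a < b)%N -> (b.+1 < w a)%N -> (w a < w b)%N -> bad_arcs w.
Proof.
move=> wK lab lba lw; have lt : (b.+1 < n)%N by have := ltn_ord (w a); lia.
pose m := Ordinal lt; have em : m = b.+1 :> nat by [].
have nwa : w m <> w a by move/perm_inj; olia.
have nwb : w m <> w b by move/perm_inj; olia.
have na : w m <> a by move=> h; have := wK m; rewrite h; olia.
have nb : w m <> b by move=> h; have := wK m; rewrite h; olia.
have [h|h|/ord_inj h] := ltngtP m (w m).
- case: (ltnP (w m) (w b)) => h'; first by apply: (@NestedArcs w b m); olia.
  by apply: (@ThreeCrossingArcs w a b m); olia.
- case: (ltnP a (w m)) => h'; first by apply: (@NestedArcs w a (w m)); rewrite ?wK; olia.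
  by apply: (@ThreeCrossingArcs w (w m) a b); rewrite ?wK; olia.
- by apply: (@CrossingArcsOverFixpoint w a b m); rewrite -?h; olia.
Qed.

(** One of the two arcs over the gap, say that of [y], differs from the straddling arc of [z]. The
    two are nested, or they cross and the margin of [z] leaves a point strictly between the later
    opener and the earlier closer. *)
Lemma thin_not_bad w : involutive w -> ~ bad_arcs w -> thin w.
Proof.
move=> wK nbad i /card_gt1P[x [y [hx hy neq]]]; apply/eqP/negPn/negP; rewrite -lt0n.
case/rank_over_gt0=> z [zi iz]; apply: nbad; move: hx hy; rewrite !inE => hx hy.
wlog {neq} neq : x y hx hy / y <> z.
  move=> H; have [e|] := eqVneq y z; last by move/eqP; apply: (H x).
  by apply: (H y x) => // e'; move: neq; rewrite e e' eqxx.
have nw : w y <> w z by move/perm_inj.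
have [h|h|/ord_inj//] := ltngtP y z; have [h'|h'|/ord_inj//] := ltngtP (w y) (w z).
- by apply: (@bad_crossing_arcs w y z wK); lia.
- by apply: (@NestedArcs w y z); lia.
- by apply: (@NestedArcs w z y); lia.
- by apply: (@bad_crossing_arcs w z y wK); lia.
Qed.

Lemma bad_arcs_pattern w : involutive w -> bad_arcs w ->
  [\/ contains_pattern w [:: 4; 3; 2; 1]%N,
      contains_pattern w [:: 4; 5; 3; 1; 2]%N
    | contains_pattern w [:: 4; 5; 6; 1; 2; 3]%N].
Proof.
move=> wK [a b|a b c|a b c].
- move=> h1 h2 h3; apply: Or31.
  exists (fun j => tnth [tuple a; b; w b; w a] j).
  by split=> -[[|[|[|[|j]]]] hj] [[|[|[|[|k]]]] hk]; rewrite ?(tnth_nth a) //= ?wK; lia.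
- move=> h1 h2 h3 h4 h5; apply: Or32.
  exists (fun j => tnth [tuple a; b; c; w a; w b] j).
  by split=> -[[|[|[|[|[|j]]]]] hj] [[|[|[|[|[|k]]]]] hk]; rewrite ?(tnth_nth a) //= ?wK ?h3; lia.
- move=> h1 h2 h3 h4 h5; apply: Or33.
  exists (fun j => tnth [tuple a; b; c; w a; w b; w c] j).
  by split=> -[[|[|[|[|[|[|j]]]]]] hj] [[|[|[|[|[|[|k]]]]]] hk]; rewrite ?(tnth_nth a) //= ?wK; lia.
Qed.

(** Nested arcs are replaced by the crossing arcs on the same ends. Over a fixed point [c], the arc
    of [a] is shortened to end at [c], and the arc of [b] covers the lost gaps. Of three crossing
    arcs the middle one is removed, since the outer two cover its gaps. *)
Lemma bad_arcs_same_support w : involutive w -> bad_arcs w ->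
  exists u, [/\ involutive u, bruhat u w, u != w & forall i, crossed w i -> crossed u i].
Proof.
move=> wK [a b h1 h2 h3|a b c h1 h2 h3 h4 h5|a b c h1 h2 h3 h4 h5].
- have tE x : x != a -> x != b -> tperm a b x = x by move=> *; rewrite tpermD // eq_sym.
  have uE x : (tperm a b * w * tperm a b) x = tperm a b (w (tperm a b x)) by rewrite !permM.
  have ua : (tperm a b * w * tperm a b) a = w b by rewrite uE tpermL tE //; olia.
  have ub : (tperm a b * w * tperm a b) b = w a by rewrite uE tpermR tE //; olia.
  exists (tperm a b * w * tperm a b); split.
  + exact: involutive_conj_tperm.
  + by apply: bruhat_conj_tperm; rewrite // ?tE; olia.
  + by apply/eqP => /permP/(_ a); rewrite ua; olia.
  move=> i /crossedP[x hx]; apply/crossedP.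
  have [ex|nxa] := eqVneq x a.
    by subst; case: (leqP i (w b)) => h; [exists a; rewrite ua|exists b; rewrite ub]; lia.
  have [ex|nxb] := eqVneq x b; first by subst; exists b; rewrite ub; lia.
  exists x; rewrite uE (tE _ nxa nxb); case: tpermP => [e|e|//]; last 1 first.
    by have := wK x; rewrite e; olia.
  by have := wK x; rewrite e; olia.
- have tE x : x != w a -> x != c -> tperm c (w a) x = x by move=> *; rewrite tpermD // eq_sym.
  set u := tperm c (w a) * w * tperm c (w a).
  have uE x : u x = tperm c (w a) (w (tperm c (w a) x)) by rewrite !permM.
  have ua : u a = c by rewrite uE (tE a) ?tpermR //; olia.
  have ub : u b = w b by rewrite uE !tE //; olia.
  exists u; split.
  + exact: involutive_conj_tperm.
  + by apply: bruhat_conj_tperm; rewrite // ?h3 ?wK ?tpermL ?tE //; olia.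
  + by apply/eqP => /permP/(_ a); rewrite ua; olia.
  move=> i /crossedP[x hx]; apply/crossedP.
  have [ex|nxa] := eqVneq x a.
    by subst x; case: (leqP i c) => h; [exists a; rewrite ua|exists b; rewrite ub]; lia.
  have nxc : x <> c by move=> e; rewrite e h3 in hx; lia.
  have nxw : x <> w a by move=> e; rewrite e wK in hx; lia.
  have nwx : w x <> w a by move/perm_inj; apply/eqP.
  have nwc : w x <> c by move=> e; apply: nxc; rewrite -(wK x) e.
  by exists x; rewrite uE (tE x) ?tE //; apply/eqP.
exists (tperm b (w b) * w); split.
- exact: remove_arc_involutive.
- by apply: remove_arc_step => //; lia.
- by apply/eqP => /permP/(_ b); rewrite permM tpermL wK; olia.
have uE x : x != b -> x != w b -> (tperm b (w b) * w) x = w x.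
  by move=> *; rewrite permM tpermD // eq_sym.
move=> i /crossedP[x hx]; apply/crossedP.
have [ex|nxb] := eqVneq x b.
  by subst; case: (leqP i (w a)) => h; [exists a|exists c]; rewrite uE; olia.
exists x; rewrite uE //; apply/eqP => ?; subst; rewrite wK in hx; lia.
Qed.

(** * From a Boolean ideal to thinness *)

Lemma boolean_thin w : involutive w -> boolean_lattice (@bruhat n) (involution_ideal w) -> thin w.
Proof.
move=> wK [k [f [f_inj f_surj f_le]]]; apply: thin_not_bad => // /(bad_arcs_same_support wK).
case=> u [uK uw neq cr].
have idealE v : involutive v -> (v \in involution_ideal w) = bruhat v w.
  by move=> vK; rewrite inE; move/involutionsP: vK => ->.
have uA : u \in involution_ideal w by rewrite idealE.
have wA : w \in involution_ideal w by rewrite idealE //; exact: connect0.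
have oneK : involutive (1 : 'S_n) by move=> x; rewrite !perm1.
have oneA : 1 \in involution_ideal w by rewrite idealE //; exact: bruhat1_involution.
have f1 : f 1 = set0.
  have : set0 \in f @: involution_ideal w by rewrite f_surj inE.
  case/imsetP=> x xA e; apply/eqP; rewrite -subset0 e -f_le //.
  by move: xA; rewrite inE => /andP[/involutionsP xK _]; apply: bruhat1_involution.
(* The atom [{z}] lies below [f w] but not below [f u]; [v] will be the involution it represents. *)
have /properP[_ [z zw zu]] : f u \proper f w.
  by rewrite properEneq -f_le // uw andbT; apply: contra neq => /eqP/f_inj->.
have : [set z] \in f @: involution_ideal w by rewrite f_surj inE.
case/imsetP=> v vA ev.
have [vK vw] : involutive v /\ bruhat v w by move: vA; rewrite inE => /andP[/involutionsP].
case: (pickP (fun x => v x != x)) => [x nx|id_v]; last first.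
  have e1 : v = 1 by apply/permP => x; rewrite perm1; apply/eqP/negbFE/id_v.
  by have /setP/(_ z) := ev; rewrite e1 f1 !inE eqxx.
have [a la _] := exists_arc vK nx.
have lt : (a.+1 < n)%N by have := ltn_ord (v a); lia.
pose b := Ordinal lt; have eb : b = a.+1 :> nat by [].
have vb : crossed v b by apply/crossedP; exists a; rewrite eb; lia.
have sv := bruhat_tperm_crossed eb vK vb.
have su := bruhat_tperm_crossed eb uK (cr _ (crossed_mono vw vb)).
have sA : tperm a b \in involution_ideal w.
  by rewrite idealE; [exact: bruhat_trans vw | exact: tpermK].
(* A non-identity element below the atom [v] has the same image; as [tperm a b] is also below [u],
   this puts [z] in [f u]. *)
have fs : f (tperm a b) = [set z].
  have := f_le _ _ sA vA; rewrite sv -ev subset1 => /esym/orP[/eqP//|/eqP].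
  rewrite -f1 => /(f_inj _ _ sA oneA)/permP/(_ a); rewrite tpermL perm1; olia.
by move: zu; have := f_le _ _ sA uA; rewrite su fs sub1set => <-.
Qed.

(** * Thin involutions avoid the patterns *)

(** The occurrence need not consist of whole arcs. Either [p2] opens an arc nested in that of [p1],
    or [p3] closes one nested in that of [p4], or [w p2 <= p2 < p3 <= w p3], against the pattern. *)
Lemma thin_avoids_4321 w : thin w -> involutive w -> avoids_pattern w [:: 4; 3; 2; 1]%N.
Proof.
move=> thw wK [f [fi fv]].
have l12 := fi (@Ordinal 4 0 isT) (@Ordinal 4 1 isT) isT.
have l23 := fi (@Ordinal 4 1 isT) (@Ordinal 4 2 isT) isT.
have l34 := fi (@Ordinal 4 2 isT) (@Ordinal 4 3 isT) isT.
have v21 := fv (@Ordinal 4 1 isT) (@Ordinal 4 0 isT).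
have v32 := fv (@Ordinal 4 2 isT) (@Ordinal 4 1 isT).
have v43 := fv (@Ordinal 4 3 isT) (@Ordinal 4 2 isT).
move: (f _) (f _) (f _) (f _) l12 l23 l34 v21 v32 v43 => /= p4 p3 p2 p1 l12 l23 l34 v21 v32 v43.
have [h|h] := ltnP p2 (w p2).
  by have := thin_non_nested thw wK l12 h; lia.
have [h'|h'] := ltnP (w p3) p3; last by lia.
have := @thin_non_nested w (w p4) (w p3) thw wK v43; rewrite !wK => /(_ h'); lia.
Qed.

(** The gap before [p3] is crossed by the arcs opening at [p1], [p2] if [p3 <= w p3], and by those
    closing at [p4], [p5] otherwise; the arc of [p1] or [p4] straddles it. *)
Lemma thin_avoids_45312 w : thin w -> involutive w -> avoids_pattern w [:: 4; 5; 3; 1; 2]%N.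
Proof.
move=> thw wK [f [fi fv]].
have l12 := fi (@Ordinal 5 0 isT) (@Ordinal 5 1 isT) isT.
have l23 := fi (@Ordinal 5 1 isT) (@Ordinal 5 2 isT) isT.
have l34 := fi (@Ordinal 5 2 isT) (@Ordinal 5 3 isT) isT.
have l45 := fi (@Ordinal 5 3 isT) (@Ordinal 5 4 isT) isT.
have v45 := fv (@Ordinal 5 3 isT) (@Ordinal 5 4 isT).
have v53 := fv (@Ordinal 5 4 isT) (@Ordinal 5 2 isT).
have v31 := fv (@Ordinal 5 2 isT) (@Ordinal 5 0 isT).
have v12 := fv (@Ordinal 5 0 isT) (@Ordinal 5 1 isT).
move: (f _) (f _) (f _) (f _) (f _) l12 l23 l34 l45 v45 v53 v31 v12 => /= p5 p4 p3 p2 p1.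
move=> l12 l23 l34 l45 v45 v53 v31 v12.
have excl := @thin_excl w w w p3 _ _ _ thw (connect0 _ _) (connect0 _ _).
have [h|h] := leqP p3 (w p3).
  have n12 : p1 != p2 by apply/eqP; olia.
  have := excl p1 p2 p1 n12; lia.
have n45 : w p4 != w p5 by apply/eqP; olia.
have := excl (w p4) (w p5) (w p4) n45; rewrite !wK; lia.
Qed.

(** If [p3 < w p1], the arcs of [p1], [p2] cross the gap before [p3.+1] and that of [p2] straddles
    it; otherwise the arcs of [p4], [p5] cross the gap before [p4] and that of [p5] straddles it. *)
Lemma thin_avoids_456123 w : thin w -> involutive w -> avoids_pattern w [:: 4; 5; 6; 1; 2; 3]%N.
Proof.
move=> thw wK [f [fi fv]].
have l12 := fi (@Ordinal 6 0 isT) (@Ordinal 6 1 isT) isT.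
have l23 := fi (@Ordinal 6 1 isT) (@Ordinal 6 2 isT) isT.
have l34 := fi (@Ordinal 6 2 isT) (@Ordinal 6 3 isT) isT.
have l45 := fi (@Ordinal 6 3 isT) (@Ordinal 6 4 isT) isT.
have l56 := fi (@Ordinal 6 4 isT) (@Ordinal 6 5 isT) isT.
have v45 := fv (@Ordinal 6 3 isT) (@Ordinal 6 4 isT).
have v56 := fv (@Ordinal 6 4 isT) (@Ordinal 6 5 isT).
have v61 := fv (@Ordinal 6 5 isT) (@Ordinal 6 0 isT).
have v12 := fv (@Ordinal 6 0 isT) (@Ordinal 6 1 isT).
have v23 := fv (@Ordinal 6 1 isT) (@Ordinal 6 2 isT).
move: (f _) (f _) (f _) (f _) (f _) (f _) l12 l23 l34 l45 l56 v45 v56 v61 v12 v23.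
move=> /= p6 p5 p4 p3 p2 p1 l12 l23 l34 l45 l56 v45 v56 v61 v12 v23.
have excl x y z i := @thin_excl w w w i x y z thw (connect0 _ _) (connect0 _ _).
have [h|h] := ltnP p3 (w p1).
  have n12 : p1 != p2 by apply/eqP; olia.
  have := excl p1 p2 p2 p3.+1 n12; lia.
have n45 : w p4 != w p5 by apply/eqP; olia.
have := excl (w p4) (w p5) (w p5) p4 n45; rewrite !wK; lia.
Qed.

End Bruhat.

Theorem theorem1p1 (n : nat) (hn : (0 < n)%N) (w : 'S_n)
    (hw : w \in involutions n) :
  boolean_lattice (@bruhat n) (involution_ideal w) <->
  [/\ avoids_pattern w [:: 4; 3; 2; 1],
      avoids_pattern w [:: 4; 5; 3; 1; 2]
    & avoids_pattern w [:: 4; 5; 6; 1; 2; 3]].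
Proof.
have wK := elimT (involutionsP w) hw; split=> [/(boolean_thin wK) thw|[av1 av2 av3]].
  by split; [exact: thin_avoids_4321|exact: thin_avoids_45312|exact: thin_avoids_456123].
by apply: thin_boolean => //; apply: thin_not_bad => // /(bad_arcs_pattern wK)[].
Qed.
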